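(* Let $L$ be a finite-dimensional Lie algebra over a field $F$ such that every two-generated proper subalgebra of $L$ is strongly solvable. (1) If $L$ is solvable but not strongly solvable, then every proper subalgebra of $L$ is strongly solvable and $L$ is two-generated. (2) If $L$ is not solvable, $F$ is infinite and $\mathrm{char}(F)>5$, then $L$ is two-generated, every proper subalgebra of $L$ is strongly solvable, and $L/\phi(L)$ is simple.
   Context: A Lie algebra $L$ is strongly solvable if its derived algebra $L^2=[L,L]$ is nilpotent. A Lie algebra (or subalgebra) is two-generated if it is generated as a Lie algebra by two of its elements. The Frattini ideal $\phi(L)$ is the largest ideal of $L$ contained in the intersection of all maximal subalgebras of $L$. *)

(* Defs.v *)
(* finite-dimensional Lie algebras over a field F are modelled
   as a vectType V over F (the whole Lie algebra L is fullv) together with a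
   bracket br : V -> V -> V satisfying the Lie algebra axioms. *)
From HB Require Import structures.
From mathcomp Require Import all_boot all_order all_algebra.
Set Implicit Arguments. Unset Strict Implicit. Unset Printing Implicit Defensive.
Import GRing.Theory.
Local Open Scope ring_scope.


Section Lie.
Variables (F : fieldType) (V : vectType F) (br : V -> V -> V).

Definition is_lie : Prop :=
  [/\ forall (a : F) (x y z : V), br (a *: x + y) z = a *: br x z + br y z,
      forall (a : F) (x y z : V), br x (a *: y + z) = a *: br x y + br x z,
      forall x : V, br x x = 0
    & forall x y z : V, br x (br y z) + br y (br z x) + br z (br x y) = 0].

(* [U, W] : the subspace spanned by all brackets [u, w], u in U, w in W
   (by bilinearity it suffices to bracket basis vectors). *)
Definition lbr (U W : {vspace V}) : {vspace V} :=
  << [seq br u w | u <- vbasis U, w <- vbasis W] >>%VS.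

Definition subalg (U : {vspace V}) : Prop := (lbr U U <= U)%VS.
Definition ideal (I : {vspace V}) : Prop := (lbr fullv I <= I)%VS.

Fixpoint lcs (S : {vspace V}) (n : nat) : {vspace V} :=
  if n is k.+1 then lbr (lcs S k) S else S.
Fixpoint dser (S : {vspace V}) (n : nat) : {vspace V} :=
  if n is k.+1 then lbr (dser S k) (dser S k) else S.

Definition nilpotent (S : {vspace V}) : Prop := exists n, lcs S n = 0%VS.
Definition solvable (S : {vspace V}) : Prop := exists n, dser S n = 0%VS.
Definition strongly_solvable (S : {vspace V}) : Prop := nilpotent (lbr S S).

Definition generated_by (X : seq V) (U : {vspace V}) : Prop :=
  [/\ subalg U, (<<X>>%VS <= U)%VS &
      forall W : {vspace V}, subalg W -> (<<X>>%VS <= W)%VS -> (U <= W)%VS].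

Definition two_generated (U : {vspace V}) : Prop :=
  exists x y : V, generated_by [:: x; y] U.

Definition proper_subalg (U : {vspace V}) : Prop := subalg U /\ U != fullv.

Definition maximal_subalg (M : {vspace V}) : Prop :=
  [/\ subalg M, M != fullv &
      forall W : {vspace V}, subalg W -> (M <= W)%VS -> W = M \/ W = fullv].

Definition is_frattini (Phi : {vspace V}) : Prop :=
  [/\ ideal Phi,
      forall M, maximal_subalg M -> (Phi <= M)%VS &
      forall I, ideal I -> (forall M, maximal_subalg M -> (I <= M)%VS) ->
        (I <= Phi)%VS].

Definition simple_lie : Prop :=
  lbr fullv%VS fullv%VS != 0%VS /\
  forall I : {vspace V}, ideal I -> I = 0%VS \/ I = fullv.

End Lie.

Definition simple_quotient (F : fieldType) (V : vectType F)
    (br : V -> V -> V) (I : {vspace V}) : Prop :=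
  exists (W : vectType F) (brW : W -> W -> W) (f : 'Hom(V, W)),
    [/\ is_lie brW, simple_lie brW,
        forall x y : V, f (br x y) = brW (f x) (f y),
        limg f = fullv & lker f = I].

(* Main.v *)
(** Suppose every two-generated subalgebra of U is strongly solvable. Let
    c = [x, y], and let M be the Fitting one-component of U under ad c. It is
    stable under ad x and ad y, because c acts nilpotently on x and y. If
    M <> 0, then, ad y being either non-injective or onto on M, there are
    (z1, z2) <> (0, 0) in M^2 with [x, z2] = [y, z1], and so
      [x + t z1, y + t z2] = c + t^2 [z1, z2]   for every scalar t.
    The left side acts nilpotently on x + t z1 and y + t z2. If F is infinite,
    the coefficient of t gives (ad c)^N z_i = 0, hence z_i = 0, a contradiction;
    if U is solvable, the same follows with t = 1, taking z1, z2 in the last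
    derived subalgebra that meets M and working modulo the next one. Hence
    all commutators are ad-nilpotent, and the Engel-Jacobson argument, applied
    to this bracket-closed set, makes [U, U] nilpotent.

    In the non-solvable case all proper subalgebras are therefore solvable, so
    the sum of a proper ideal and a proper subalgebra is proper; the largest
    proper ideal is then the Frattini ideal, with simple quotient. *)
Require Import Defs.
From HB Require Import structures.
From mathcomp Require Import all_boot all_order all_algebra.
From Stdlib Require Import Classical.
Set Implicit Arguments. Unset Strict Implicit. Unset Printing Implicit Defensive.
Import GRing.Theory.
Local Open Scope ring_scope.

(** * Iterates of endomorphisms, polynomials with vector coefficients, maximal subspaces *)

Section LinearAlgebra.
Variables (F : fieldType) (V : vectType F).

Lemma linfunP (g : V -> V) : linear g -> linfun g =1 g.
Proof.
move=> gl; pose G : {linear V -> V} :=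
  HB.pack g (GRing.isLinear.Build F V V *:%R g gl).
exact: (lfunE G).
Qed.

Definition fpow (f : 'End(V)) n : 'End(V) := iter n (comp_lfun f) \1%VF.

Lemma fpowE f n v : fpow f n v = iter n f v.
Proof. by elim: n => [|n IH] /=; rewrite ?id_lfunE // comp_lfunE IH. Qed.

Lemma iter_lin0 (f : 'End(V)) n : iter n f 0 = 0.
Proof. by elim: n => //= n ->; rewrite linear0. Qed.

Lemma iter0_leq (f : 'End(V)) m n v :
  (m <= n)%N -> iter m f v = 0 -> iter n f v = 0.
Proof. by move=> /subnK <-; rewrite iterD => ->; exact: iter_lin0. Qed.

(** Kernels of powers grow strictly until they become constant; strict growth up to this exponent
    would exceed the dimension. *)
Lemma nil_index (f : 'End(V)) n v :
  iter n f v = 0 -> iter (\dim {:V}).+1 f v = 0.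
Proof.
pose K k := lker (fpow f k).
have memK k u : (u \in K k) = (iter k f u == 0) by rewrite memv_ker fpowE.
have KS k : (K k <= K k.+1)%VS.
  by apply/subvP=> u; rewrite !memK => /eqP /(iter0_leq (leqnSn k)) ->.
suff: forall k, (k <= \dim (K k))%N \/ forall n u, u \in K n -> u \in K k.
  case/(_ (\dim {:V}).+1) => [|stab].
    by move=> /leq_trans/(_ (dimvS (subvf _))); rewrite ltnn.
  by move=> /eqP; rewrite -memK => /stab; rewrite memK => /eqP.
elim=> [|k [IH|IH]]; first by left.
  have [eqK|neqK] := eqVneq (K k) (K k.+1); last first.
    left; apply: leq_ltn_trans IH _.
    by rewrite (ltn_leqif (dimv_leqif_eq (KS k))).
  right; elim=> [|m IHm] u; first by rewrite memK => /= /eqP ->; rewrite mem0v.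
  rewrite memK iterSr -memK => /IHm fuK; have : f u \in K k by rewrite eqK.
  by rewrite !memK -iterSr.
by right=> m u /IH; apply: (subvP (KS k)).
Qed.

Lemma inj_or_onto (f : 'End(V)) (M : {vspace V}) : (f @: M <= M)%VS ->
  (exists z, [/\ z \in M, z != 0 & f z = 0]) \/
  (forall u, u \in M -> exists2 z, z \in M & u = f z).
Proof.
move=> fM; have [k0|kn0] := eqVneq (M :&: lker f)%VS 0%VS.
  right=> u; have /eqP eqM : (f @: M == M)%VS
    by rewrite eqEdim fM limg_dim_eq /=.
  by rewrite -{1}eqM => /memv_imgP.
left; exists (vpick (M :&: lker f)).
have := memv_pick (M :&: lker f); rewrite memv_cap memv_ker => /andP[zM /eqP fz].
by rewrite vpick0.
Qed.

Definition infinite_field := forall s : seq F, exists x : F, x \notin s.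

Lemma poly_vanish (p : {poly F}) :
  infinite_field -> (forall t, p.[t] = 0) -> p = 0.
Proof.
move=> infF p0.
have lists n : exists2 s : seq F, uniq s & size s = n.
  elim: n => [|n [s us <-]]; first by exists [::].
  by have [x xs] := infF s; exists (x :: s); rewrite //= xs.
apply/eqP/negPn/negP => pn0; have [s us ss] := lists (size p).
have /(max_poly_roots pn0)/(_ us) : all (root p) s
  by apply/allP=> x _; apply/rootP.
by rewrite ss ltnn.
Qed.

(** An element of F[t] ⊗ V, kept as a list of pure tensors and evaluated at [t]. *)
Definition vpoly (s : seq ({poly F} * V)) (t : F) : V :=
  \sum_(pe <- s) pe.1.[t] *: pe.2.

(** Each linear form yields a polynomial vanishing on an infinite field, with the form's value at
    [b] as coefficient of t. *)
Lemma vpoly_linear_coef (b : V) s : infinite_field ->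
  (forall t, t *: b + t ^+ 2 *: vpoly s t = 0) -> b = 0.
Proof.
move=> infF H; suff vanish (phi : {scalar V}) : phi b = 0.
  rewrite (coord_vbasis (memvf b)); apply: big1 => i _.
  by rewrite vanish scale0r.
pose q := phi b *: 'X + 'X^2 * \sum_(pe <- s) phi pe.2 *: pe.1.
have : q = 0.
  apply: poly_vanish => // t; have /(congr1 phi) := H t.
  rewrite linear0 linearD !linearZ /= => <-.
  rewrite /q hornerD hornerZ hornerX hornerM hornerXn mulrC; congr (_ + _ * _).
  rewrite horner_sum /vpoly linear_sum; apply: eq_bigr => pe _.
  by rewrite linearZ /= hornerZ mulrC.
move/(congr1 (fun p : {poly F} => p`_1)).
by rewrite coefD coefZ coefX coefXnM coef0 /= mulr1 addr0.
Qed.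

Lemma vpolyD s1 s2 t : vpoly (s1 ++ s2) t = vpoly s1 t + vpoly s2 t.
Proof. exact: big_cat. Qed.

Lemma vpoly_lin (g : 'End(V)) s t :
  vpoly [seq (pe.1, g pe.2) | pe <- s] t = g (vpoly s t).
Proof.
rewrite /vpoly big_map linear_sum; apply: eq_bigr => pe _; by rewrite linearZ.
Qed.

Lemma vpolyM (p : {poly F}) s t :
  vpoly [seq (p * pe.1, pe.2) | pe <- s] t = p.[t] *: vpoly s t.
Proof.
rewrite /vpoly big_map scaler_sumr; apply: eq_bigr => pe _.
by rewrite hornerM scalerA.
Qed.

(** Since [g] enters with t^2, the iterate agrees with that of [f] modulo t^2. *)
Lemma iter_pencil (f g : 'End(V)) x z k : exists s, forall t,
  iter k (fun v => f v + t ^+ 2 *: g v) (x + t *: z) =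
  iter k f x + (t *: iter k f z + t ^+ 2 *: vpoly s t).
Proof.
elim: k => [|k [s IH]].
  by exists [::] => t; rewrite /= /vpoly big_nil scaler0 addr0.
(* With R the old remainder, the new one is f R + t^2 g R plus [g] of the constant and linear
   terms. *)
exists ([seq (pe.1, f pe.2) | pe <- s] ++ [:: (1, g (iter k f x));
  ('X, g (iter k f z))] ++ [seq ('X^2 * pe.1, pe.2)
     | pe <- [seq (pe.1, g pe.2) | pe <- s]]) => t.
rewrite !iterS IH !vpolyD vpolyM !vpoly_lin /= hornerXn /vpoly !big_cons big_nil.
rewrite -/(vpoly s t) hornerX hornerC scale1r addr0 !linearD !linearZ /=.
by rewrite -!addrA.
Qed.

Lemma max_subspace (P : {vspace V} -> Prop) U0 : P U0 ->
  exists U, [/\ P U, (U0 <= U)%VS & forall W, P W -> (U <= W)%VS -> W = U].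
Proof.
have [n] := ubnP (\dim {:V} - \dim U0)%N.
elim: n U0 => // n IH U0 /ltnSE le_n P0.
case: (classic (exists W, [/\ P W, (U0 <= W)%VS & W != U0])) => [|nW].
  case=> W [PW sW neW]; have ltW : (\dim U0 < \dim W)%N.
    by rewrite (ltn_leqif (dimv_leqif_eq sW)) eq_sym.
  have leW : (\dim W <= \dim {:V})%N by rewrite dimvS ?subvf.
  have [|U [PU sU mU]] := IH W _ PW.
    by rewrite (leq_trans _ le_n) // ltn_sub2l // (leq_trans ltW).
  by exists U; split=> //; apply: subv_trans sU.
exists U0; split=> // W PW sW; apply/eqP/negPn/negP => neW.
by apply: nW; exists W.
Qed.

End LinearAlgebra.

(** * Bracket calculus, derived series, generated subalgebras *)

Section LieAlgebra.
Variables (F : fieldType) (V : vectType F) (br : V -> V -> V).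
Hypothesis lieB : is_lie br.
Local Notation "U ⊗ W" := (lbr br U W) (at level 40).
Implicit Types (U W S T I J M : {vspace V}).

Definition ad x : 'End(V) := linfun (br x).

Lemma adE x y : ad x y = br x y.
Proof. by apply: linfunP => a u v; case: lieB. Qed.

Lemma iter_adE n x y : iter n (ad x) y = iter n (br x) y.
Proof. by apply: eq_iter => z; exact: adE. Qed.

Lemma brDr x y z : br x (y + z) = br x y + br x z.
Proof. by rewrite -!adE linearD. Qed.

Lemma brZr a x y : br x (a *: y) = a *: br x y.
Proof. by rewrite -!adE linearZ. Qed.

Lemma br0r x : br x 0 = 0.
Proof. by rewrite -adE linear0. Qed.

Lemma brxx x : br x x = 0.
Proof. by case: lieB. Qed.

Lemma brDl x y z : br (x + y) z = br x z + br y z.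
Proof. by case: lieB => /(_ 1 x y z); rewrite !scale1r. Qed.

Lemma brC x y : br y x = - br x y.
Proof.
have := brxx (x + y); rewrite brDl !brDr !brxx add0r addr0 => /eqP.
by rewrite addrC addr_eq0 => /eqP.
Qed.

Lemma brNr x y : br x (- y) = - br x y.
Proof. by rewrite -!adE linearN. Qed.

Lemma brZl a x y : br (a *: x) y = a *: br x y.
Proof. by rewrite brC brZr -scalerN -brC. Qed.

Lemma brNl x y : br (- x) y = - br x y.
Proof. by rewrite brC brNr -brC. Qed.

Lemma br0l x : br 0 x = 0.
Proof. by rewrite brC br0r oppr0. Qed.

Lemma jacobi x y z : br x (br y z) = br (br x y) z + br y (br x z).
Proof.
case: lieB => _ _ _ /(_ x y z) /eqP; rewrite -addrA addr_eq0 => /eqP ->.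
by rewrite (brC x z) brNr (brC (br x y) z) opprD !opprK addrC.
Qed.

Lemma span_br_sub (X Y : seq V) W :
  (forall x y, x \in X -> y \in Y -> br x y \in W) ->
  forall u v, u \in <<X>>%VS -> v \in <<Y>>%VS -> br u v \in W.
Proof.
(* Vectors whose bracket with [u] lies in [W] form the preimage of [W] under [ad u], so spanning
   vectors suffice; antisymmetry then treats the other argument. *)
move=> XYW u v uX vY; rewrite -adE memv_preim; apply: (subvP _ _ vY).
apply/span_subvP=> y yY; rewrite -memv_preim adE brC rpredN -adE memv_preim.
apply: (subvP _ _ uX); apply/span_subvP=> x xX.
by rewrite -memv_preim adE brC rpredN XYW.
Qed.

Lemma mem_lbr U W u w : u \in U -> w \in W -> br u w \in U ⊗ W.
Proof.
rewrite -{1}(span_basis (vbasisP U)) -{1}(span_basis (vbasisP W)).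
apply: span_br_sub => x y xU yW; apply: memv_span.
by apply/allpairsP; exists (x, y).
Qed.

Lemma lbr_subP U W S :
  reflect (forall u w, u \in U -> w \in W -> br u w \in S) (U ⊗ W <= S)%VS.
Proof.
apply: (iffP idP) => [/subvP sub u w uU wW | sub]; first by rewrite sub ?mem_lbr.
apply/span_subvP=> _ /allpairsP[[u w] [uU wW ->]].
by rewrite sub //= vbasis_mem.
Qed.

Lemma lbrS U U' W W' : (U <= U')%VS -> (W <= W')%VS -> (U ⊗ W <= U' ⊗ W')%VS.
Proof.
move=> /subvP sU /subvP sW; apply/lbr_subP=> u w uU wW.
by rewrite mem_lbr ?sU ?sW.
Qed.

Lemma lbr_sym U W : U ⊗ W = W ⊗ U.
Proof.
apply/eqP; rewrite eqEsubv.
by apply/andP; split; apply/lbr_subP=> u w uU wW; rewrite brC rpredN mem_lbr.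
Qed.

Lemma ideal_br I x y : ideal br I -> y \in I -> br x y \in I.
Proof. by move=> /lbr_subP idI yI; rewrite idI ?memvf. Qed.

Lemma ideal_subalg I : ideal br I -> subalg br I.
Proof. by apply: subv_trans; rewrite lbrS ?subvf. Qed.

Lemma subalg_br U x y : subalg br U -> x \in U -> y \in U -> br x y \in U.
Proof. by move=> /lbr_subP; exact. Qed.

Lemma iter_br_mem U n x y :
  subalg br U -> x \in U -> y \in U -> iter n (br x) y \in U.
Proof. by move=> sU xU yU; elim: n => //= n IH; exact: subalg_br. Qed.

Lemma dserS U W n : (U <= W)%VS -> (dser br U n <= dser br W n)%VS.
Proof. by move=> sUW; elim: n => //= n IH; apply: lbrS. Qed.

Lemma dserD U m n : dser br U (m + n) = dser br (dser br U m) n.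
Proof. by elim: n => [|n IH]; rewrite ?addn0 // addnS /= IH. Qed.

Lemma dser_sub U n : subalg br U -> (dser br U n <= U)%VS.
Proof.
by move=> sU; elim: n => //= n IH; apply: subv_trans sU; apply: lbrS.
Qed.

Lemma dser_stable U n x y : subalg br U ->
  x \in U -> y \in dser br U n -> br x y \in dser br U n.
Proof.
move=> sU xU; elim: n y => [|n IH] y /=; first exact: subalg_br.
rewrite -adE memv_preim; apply/subvP/lbr_subP=> u w uD wD.
rewrite -memv_preim adE jacobi; apply: rpredD.
  by apply: mem_lbr wD; exact: IH.
by apply: mem_lbr uD _; exact: IH.
Qed.

Lemma strongly_solvable_solvable S :
  subalg br S -> strongly_solvable br S -> solvable br S.
Proof.
move=> sS [n lcs0]; exists n.+1; apply/eqP; rewrite -subv0 -lcs0.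
(* The derived series of [S], shifted by one, lies below the lower central series of [S, S]. *)
elim: n {lcs0} => [|n IH]; first exact: subvv.
by apply: lbrS IH _; apply: lbrS; exact: dser_sub.
Qed.

(** Adding [W, W] to [W] raises the dimension until [W] is closed, and [W] stays inside every
    subalgebra containing [X]. *)
Lemma generated_exists (X : seq V) : exists U, generated_by br X U.
Proof.
suff: forall W, (<<X>> <= W)%VS ->
    (forall S, subalg br S -> (<<X>> <= S)%VS -> (W <= S)%VS) ->
    exists U, generated_by br X U.
  by apply; first exact: subvv.
move=> W; have [n] := ubnP (\dim {:V} - \dim W)%N.
elim: n W => // n IH W /ltnSE le_n XW minW.
have [sW|nsW] := boolP (W ⊗ W <= W)%VS; first by exists W.
have ltW : (\dim W < \dim (W + W ⊗ W))%N.
  rewrite (ltn_leqif (dimv_leqif_sup (addvSl _ _))).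
  by apply: contra nsW => /(subv_trans (addvSr _ _)).
have leW : (\dim (W + W ⊗ W) <= \dim {:V})%N by rewrite dimvS ?subvf.
apply: (IH (W + W ⊗ W)%VS).
- by rewrite (leq_trans _ le_n) // ltn_sub2l // (leq_trans ltW).
- by apply: subv_trans XW (addvSl _ _).
move=> S sS XS; rewrite subv_add minW //=.
by apply: subv_trans (sS); apply: lbrS; exact: minW.
Qed.

(** * Nilpotent action of commutators in two-generated subalgebras *)

Local Notation N := (\dim {:V}).+1.

(** As [c] lies in [T, T], [ad c] maps [T] into [T, T] and then down its lower central series. *)
Lemma strongly_solvable_comm_nil T a b t : subalg br T ->
  strongly_solvable br T -> a \in T -> b \in T -> t \in T ->
  iter N (br (br a b)) t = 0.
Proof.
move=> sT [n lcs0] aT bT tT; set c := br a b.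
have cD : c \in T ⊗ T by exact: mem_lbr.
have cT : c \in T by exact: subalg_br.
have memL k : iter k.+1 (br c) t \in lcs br (T ⊗ T) k.
  elim: k => [|k IH]; first exact: mem_lbr.
  by rewrite iterS /= lbr_sym; exact: mem_lbr.
rewrite -iter_adE; apply: (@nil_index _ _ _ n.+1); apply/eqP.
by rewrite iter_adE -memv0 -lcs0.
Qed.

Definition two_gen_strongly_solvable U := forall T,
  subalg br T -> (T <= U)%VS -> two_generated br T -> strongly_solvable br T.

(** Only the action on [x] and [y] is obtained, as the hypothesis sees just the subalgebra they
    generate. *)
Lemma two_gen_comm_nil U x y : subalg br U -> two_gen_strongly_solvable U ->
  x \in U -> y \in U ->
  iter N (br (br x y)) x = 0 /\ iter N (br (br x y)) y = 0.
Proof.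
move=> sU ssU xU yU; have [T genT] := generated_exists [:: x; y].
have [sT XT minT] := genT.
have [xT yT] : x \in T /\ y \in T.
  by split; apply: (subvP XT); apply: memv_span; rewrite !inE eqxx ?orbT.
have ssT : strongly_solvable br T.
  apply: ssU => //; last by exists x, y.
  by apply: minT => //; apply/span_subvP=> z; rewrite !inE => /orP[]/eqP ->.
by split; apply: (strongly_solvable_comm_nil sT).
Qed.

(* By Leibniz, fewer than [n] of the [m + n] factors [ad c] can fall on [a]. *)
Lemma iter_past_nil U c a n m u : subalg br U -> c \in U ->
  a \in U -> iter n (br c) a = 0 -> u \in U ->
  exists2 v, v \in U & br a (iter (m + n) (br c) u) = iter m (br c) v.
Proof.
move=> sU cU; elim: n a m u => [|n IHn] a m u aU.
  by move=> /= -> _; exists 0; rewrite ?mem0v // br0l -iter_adE iter_lin0.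
rewrite iterSr => ca0 uU; elim: m => [|m [v vU IHm]].
  by eexists; [|reflexivity]; rewrite subalg_br ?iter_br_mem.
have [w wU Ew] := IHn (br c a) m.+1 u (subalg_br sU cU aU) ca0 uU.
exists (v - w); first by rewrite rpredB.
have -> : iter m.+1 (br c) (v - w) = iter m.+1 (br c) v - iter m.+1 (br c) w.
  by rewrite -!iter_adE -!fpowE linearB.
rewrite -Ew iterS -IHm addSn iterS jacobi (brC c a) addSnnS brNl.
by rewrite addrC.
Qed.

(** * The Fitting one-component *)

Section FittingOne.
Variables (U : {vspace V}) (c : V).
Hypotheses (sU : subalg br U) (cU : c \in U).

Definition fitting_one : {vspace V} := (fpow (ad c) N @: U)%VS.

Lemma fitting_oneP v :
  reflect (exists2 u, u \in U & v = iter N (br c) u) (v \in fitting_one).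
Proof.
apply: (iffP idP) => [/memv_imgP[u uU ->]|[u uU ->]]; [|apply/memv_imgP];
by exists u; rewrite // fpowE iter_adE.
Qed.

Lemma fitting_one_sub : (fitting_one <= U)%VS.
Proof. by apply/subvP=> _ /fitting_oneP[u uU ->]; exact: iter_br_mem. Qed.

Lemma fitting_one_inj n v : v \in fitting_one -> iter n (br c) v = 0 -> v = 0.
Proof.
move=> /fitting_oneP[u uU ->]; rewrite -iterD -!iter_adE; exact: nil_index.
Qed.

(** (ad c)^N is injective, hence onto, on the Fitting component, so [v] is (ad c)^(2N) u; moving [a]
    inward leaves (ad c)^N in front. *)
Lemma fitting_one_stable a v : a \in U -> iter N (br c) a = 0 ->
  v \in fitting_one -> br a v \in fitting_one.
Proof.
move=> aU ca0 vM.
have sM : (fpow (ad c) N @: fitting_one <= fitting_one)%VS.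
  by apply: limgS; exact: fitting_one_sub.
case: (inj_or_onto sM) => [[z [zM /eqP zn0 cz0]] | /(_ v vM) [z]].
  by case: zn0; apply: (fitting_one_inj zM (n := N)); rewrite -iter_adE -fpowE.
move=> /fitting_oneP[u uU ->]; rewrite fpowE iter_adE -iterD => ->.
have [w wU ->] := iter_past_nil N sU cU aU ca0 uU.
by apply/fitting_oneP; exists w.
Qed.

End FittingOne.

(** * Ad-nilpotency of all commutators *)

Lemma commutation_pair x y M : M != 0%VS ->
  (forall z, z \in M -> br x z \in M) -> (forall z, z \in M -> br y z \in M) ->
  exists z1 z2, [/\ z1 \in M, z2 \in M, z1 != 0 \/ z2 != 0
                 & br x z2 = br y z1].
Proof.
move=> Mn0 xM yM; have adyM : (ad y @: M <= M)%VS.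
  by apply/subvP=> _ /memv_imgP[z zM ->]; rewrite adE yM.
(* A kernel vector z of [ad y] gives the pair (z, 0); otherwise [y, z1] = [x, z2] is solvable in z1
   for any nonzero z2 in [M]. *)
case: (inj_or_onto adyM) => [[z [zM zn0]] | onto].
  by rewrite adE => yz0; exists z, 0; split; rewrite ?mem0v ?br0r //; left.
have pM := memv_pick M; have [z zM Ez] := onto _ (xM _ pM).
by exists z, (vpick M); split; rewrite ?vpick0 ?Ez ?adE //; right.
Qed.

(** The terms linear in t cancel, being [x, z2] - [y, z1]. *)
Lemma br_pencil x y z1 z2 t : br x z2 = br y z1 ->
  br (x + t *: z1) (y + t *: z2) = br x y + t ^+ 2 *: br z1 z2.
Proof.
move=> Exy; rewrite !brDl !brDr !brZl !brZr Exy (brC y z1) scalerN scalerA.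
by rewrite addrA addrK expr2.
Qed.

Lemma comm_nil_infinite U x y u : infinite_field F ->
  subalg br U -> two_gen_strongly_solvable U ->
  x \in U -> y \in U -> u \in U -> iter N (br (br x y)) u = 0.
Proof.
move=> infF sU ssU xU yU uU; set c := br x y.
have cU : c \in U by exact: subalg_br.
have [cx0 cy0] := two_gen_comm_nil sU ssU xU yU.
have [M0|Mn0] := eqVneq (fitting_one U c) 0%VS.
  by apply/eqP; rewrite -memv0 -M0; apply/fitting_oneP; exists u.
have xM z := fitting_one_stable sU cU xU cx0 (v := z).
have yM z := fitting_one_stable sU cU yU cy0 (v := z).
have [z1 [z2 [z1M z2M zn0 Exy]]] := commutation_pair Mn0 xM yM.
have [z1U z2U] : z1 \in U /\ z2 \in U.
  by split; apply: (subvP (fitting_one_sub sU cU)).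
have pencil t := two_gen_comm_nil sU ssU (rpredD xU (rpredZ t z1U))
  (rpredD yU (rpredZ t z2U)).
(* The constant term (ad c)^N a is zero, so the coefficient of t, namely (ad c)^N z, vanishes as
   well. *)
have kill a z : iter N (br c) a = 0 -> z \in fitting_one U c -> (forall t,
    iter N (br (c + t ^+ 2 *: br z1 z2)) (a + t *: z) = 0) -> z = 0.
  move=> ca0 zM H; apply: (fitting_one_inj (n := N) zM); rewrite -iter_adE.
  have [s Es] := iter_pencil (ad c) (ad (br z1 z2)) a z N.
  apply: (vpoly_linear_coef (s := s) infF) => t.
  have := Es t; rewrite iter_adE ca0 add0r => <-; rewrite -[RHS](H t).
  by apply: eq_iter => v; rewrite !adE brDl brZl.
have z10 : z1 = 0.
  by apply: (kill x) => // t; rewrite -br_pencil //; case: (pencil t).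
have z20 : z2 = 0.
  by apply: (kill y) => // t; rewrite -br_pencil //; case: (pencil t).
by case: zn0; rewrite (z10, z20) eqxx.
Qed.

Lemma comm_nil_solvable U x y u : solvable br U ->
  subalg br U -> two_gen_strongly_solvable U ->
  x \in U -> y \in U -> u \in U -> iter N (br (br x y)) u = 0.
Proof.
move=> solU sU ssU xU yU uU; set c := br x y.
have cU : c \in U by exact: subalg_br.
have [cx0 cy0] := two_gen_comm_nil sU ssU xU yU.
have [M0|Mn0] := eqVneq (fitting_one U c) 0%VS.
  by apply/eqP; rewrite -memv0 -M0; apply/fitting_oneP; exists u.
pose P k := (fitting_one U c :&: dser br U k == 0)%VS.
have exP : exists k, P k by case: solU => k D0; exists k; rewrite /P D0 capv0.
(* The least index is not 0, as [U] contains the nonzero Fitting component; so the i-th derived term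
   is the last to meet it. *)
case: (ex_minnP exP) => -[|i].
  by rewrite /P (capv_idPl (fitting_one_sub sU cU)) (negPf Mn0).
set D := dser br U i.+1 => /eqP capD minD.
have {Mn0} Mn0 : (fitting_one U c :&: dser br U i != 0)%VS.
  by apply/negP => /minD; rewrite ltnn.
have stab a z : a \in U -> iter N (br c) a = 0 ->
    z \in (fitting_one U c :&: dser br U i)%VS ->
    br a z \in (fitting_one U c :&: dser br U i)%VS.
  move=> aU ca0; rewrite !memv_cap => /andP[zM zD].
  by rewrite fitting_one_stable // dser_stable.
have [z1 [z2 [z1M z2M zn0 Exy]]] :=
  commutation_pair Mn0 (fun z => stab x z xU cx0) (fun z => stab y z yU cy0).
move: z1M z2M; rewrite !memv_cap => /andP[z1M z1D] /andP[z2M z2D].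
have [z1U z2U] : z1 \in U /\ z2 \in U.
  by split; apply: (subvP (fitting_one_sub sU cU)).
have := br_pencil 1 Exy; rewrite expr1n !scale1r => Ec.
have [] := two_gen_comm_nil sU ssU (rpredD xU z1U) (rpredD yU z2U).
rewrite Ec -/c; set w := br z1 z2 => cx0' cy0'.
have wD : w \in D by exact: mem_lbr.
have c'U : c + w \in U by rewrite rpredD // subalg_br.
(* [c] and [c + w] act alike modulo [D], which is stable under [U]. *)
have near k v : v \in U -> iter k (br (c + w)) v - iter k (br c) v \in D.
  move=> vU; elim: k => [|k IH]; first by rewrite subrr mem0v.
  rewrite !iterS brDl addrAC -brNr -brDr rpredD //.
    exact: dser_stable.
  by rewrite brC rpredN dser_stable ?iter_br_mem.
have kill a z : a \in U -> iter N (br c) a = 0 -> z \in fitting_one U c ->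
    iter N (br (c + w)) (a + z) = 0 -> z = 0.
  move=> aU ca0 zM c'0; have zU := subvP (fitting_one_sub sU cU) _ zM.
  (* (ad c)^N z lies in the Fitting component and in [D], which meet only in 0. *)
  apply: (fitting_one_inj (n := N) zM); apply/eqP; rewrite -memv0 -capD.
  rewrite memv_cap; apply/andP; split; first by apply/fitting_oneP; exists z.
  have := near N _ (rpredD aU zU); rewrite c'0 sub0r rpredN.
  suff -> : iter N (br c) (a + z) = iter N (br c) z by [].
  by rewrite -[RHS]add0r -ca0 -!iter_adE -!fpowE linearD.
by case: zn0; rewrite (kill _ _ _ _ _ cx0', kill _ _ _ _ _ cy0') ?eqxx.
Qed.

(** * The Engel-Jacobson argument *)

Section ExtendAction.
Variables (U W : {vspace V}) (d : V).
Hypotheses (sU : subalg br U) (WU : (W <= U)%VS) (dU : d \in U).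
Hypothesis dW : forall w, w \in W -> br d w \in W.
Hypothesis dnil : forall u, u \in U -> iter N (br d) u = 0.
Local Notation W' := (W + <[d]>)%VS.

(** Among N brackets, either one is with [W], landing in [W, S], which stays stable, or all are with
    [d], and (ad d)^N kills [U]. *)
Lemma extend_step S : (S <= U)%VS -> (W ⊗ S <= S)%VS ->
  (forall s, s \in S -> br d s \in S) -> (iter N (lbr br W') S <= W ⊗ S)%VS.
Proof.
move=> SU WS dS.
have dWS p : p \in W ⊗ S -> br d p \in W ⊗ S.
  rewrite -adE memv_preim; apply/subvP/lbr_subP=> w s wW sS.
  by rewrite -memv_preim adE jacobi rpredD ?mem_lbr ?dW ?dS.
suff step k : (iter k (lbr br W') S <= W ⊗ S + (fpow (ad d) k @: S))%VS.
  apply: subv_trans (step N) _; rewrite subv_add subvv.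
  apply/subvP=> _ /memv_imgP[s sS ->].
  by rewrite fpowE iter_adE dnil ?mem0v // (subvP SU).
elim: k => [|k IH].
  apply: subv_trans (addvSr _ _); apply/subvP=> s sS.
  by apply/memv_imgP; exists s; rewrite ?fpowE.
rewrite iterS; apply/lbr_subP=> _ v /memv_addP[w wW [_ /vlineP[a ->] ->]].
move=> /(subvP IH) /memv_addP[p pWS [_ /memv_imgP[s sS ->] ->]].
have fS : fpow (ad d) k s \in S.
  by rewrite fpowE iter_adE; elim: (k) => //= j; exact: dS.
rewrite brDl brZl; apply: rpredD.
  apply: (subvP (addvSl _ _)); apply: mem_lbr => //.
  by rewrite rpredD // (subvP WS).
rewrite rpredZ // brDr memv_add ?dWS //.
by apply/memv_imgP; exists s; rewrite // !fpowE iterS adE.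
Qed.

Lemma iter_lbr_props n : let A := iter n (lbr br W) U in
  [/\ (A <= U)%VS, (W ⊗ A <= A)%VS & forall s, s \in A -> br d s \in A].
Proof.
elim: n => [|n [AU WA dA]] /=.
  split=> [||s]; [exact: subvv | | exact: subalg_br].
  by apply: subv_trans sU; apply: lbrS.
split; [exact: subv_trans AU | exact: lbrS|].
move=> p; rewrite -adE memv_preim; apply/subvP/lbr_subP=> w s wW sS.
by rewrite -memv_preim adE jacobi rpredD ?mem_lbr ?dW ?dA.
Qed.

Lemma extend_nil n : iter n (lbr br W) U = 0%VS ->
  iter (n * N) (lbr br W') U = 0%VS.
Proof.
move=> An0; apply/eqP; rewrite -subv0 -An0; elim: n {An0} => [|n IH].
  exact: subvv.
have [AU WA dA] := iter_lbr_props n.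
rewrite mulSn iterD; apply: subv_trans (extend_step AU WA dA).
move: (iter (n * N) _ U) IH => B BA.
by elim: N => //= k IHk; apply: lbrS.
Qed.

End ExtendAction.

Section Engel.
Variable U : {vspace V}.
Hypothesis sU : subalg br U.
Hypothesis cnil : forall x y u,
  x \in U -> y \in U -> u \in U -> iter N (br (br x y)) u = 0.

(** Single brackets, not their span: ad-nilpotency is assumed for these, and they are closed under
    the bracket. *)
Definition is_comm c := exists x y, [/\ x \in U, y \in U & c = br x y].

Definition comm_nil_subalg W := exists X : seq V,
  [/\ W = <<X>>%VS, forall c, c \in X -> is_comm c, subalg br W
    & exists n, iter n (lbr br W) U = 0%VS].

Lemma is_comm_mem c : is_comm c -> c \in U.
Proof. by case=> x [y [xU yU ->]]; exact: subalg_br. Qed.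

(** Bracketing [c] with elements of [X] while staying outside [W] must end, as [n] brackets with [W]
    kill [U]; the last commutator outside normalises [W]. *)
Lemma normalizing_comm W (X : seq V) n c : W = <<X>>%VS ->
  (forall c, c \in X -> is_comm c) -> iter n (lbr br W) U = 0%VS ->
  is_comm c -> c \notin W ->
  exists d, [/\ is_comm d, d \notin W & forall w, w \in W -> br d w \in W].
Proof.
move=> EW Xc An0 cc cW.
suff: forall k d, is_comm d -> d \notin W ->
    d \in iter (n - k) (lbr br W) U ->
    exists d, [/\ is_comm d, d \notin W & forall w, w \in W -> br d w \in W].
  by move=> /(_ n c cc cW); rewrite subnn; apply; exact: is_comm_mem.
elim=> [|k IH] d dc dW.
  by rewrite subn0 An0 memv0 => /eqP d0; rewrite d0 mem0v in dW.
have [/allP dX _|/allPn[u uX udW] dA] := boolP (all (fun u => br u d \in W) X).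
  exists d; split=> // w; rewrite {1}EW brC rpredN => wX.
  rewrite -rpredN -brC -adE memv_preim; apply: (subvP _ _ wX).
  apply/span_subvP=> u uX; rewrite -memv_preim adE brC rpredN; exact: dX.
have uW : u \in W by rewrite EW memv_span.
(* For n <= k both truncated differences are 0 and the same [d] serves. *)
have [le_nk|lt_kn] := leqP n k.
  apply: (IH d) => //; move: dA; have /eqP -> : (n - k.+1 == 0)%N.
    by rewrite subn_eq0 (leq_trans le_nk).
  by have /eqP -> : (n - k == 0)%N by rewrite subn_eq0.
apply: (IH (br u d)) => //.
  by exists u, d; split=> //; apply: is_comm_mem => //; exact: Xc.
by rewrite -(subnSK lt_kn) iterS; exact: mem_lbr.
Qed.

(** While [W] misses a commutator, a normalising one outside [W] enlarges it; the dimension bounds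
    this process, which ends at [U, U]. *)
Lemma comm_nil_subalg_derived : comm_nil_subalg (U ⊗ U).
Proof.
suff: forall W, comm_nil_subalg W -> comm_nil_subalg (U ⊗ U).
  move=> /(_ 0%VS); apply; exists [::]; split=> //; first by rewrite span_nil.
    by apply/lbr_subP=> u w; rewrite memv0 => /eqP -> _; rewrite br0l mem0v.
  exists 1%N; apply/eqP; rewrite -subv0 /=; apply/lbr_subP=> u w.
  by rewrite memv0 => /eqP -> _; rewrite br0l mem0v.
move=> W; have [m] := ubnP (\dim {:V} - \dim W)%N.
elim: m W => // m IH W /ltnSE le_m goodW; have [X [EW Xc sW [n An0]]] := goodW.
have XU c : c \in X -> c \in U by move=> /Xc /is_comm_mem.
have WU : (W <= U)%VS by rewrite EW; apply/span_subvP.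
have WD : (W <= U ⊗ U)%VS.
  rewrite EW; apply/span_subvP=> c /Xc [x [y [xU yU ->]]]; exact: mem_lbr.
have [DW|] := boolP (U ⊗ U <= W)%VS.
  by suff -> : U ⊗ U = W by []; apply/eqP; rewrite eqEsubv DW.
rewrite {1}/lbr => /span_subvP nsub.
have [c cc cW] : exists2 c, is_comm c & c \notin W.
  have [all_in|/allPn[c cD cW]] := boolP (all (fun c => c \in W)
     [seq br u w | u <- vbasis U, w <- vbasis U]).
    by case: nsub => c cD; exact: (allP all_in).
  exists c => //; case/allpairsP: cD => -[x y] /= [xU yU ->].
  by exists x, y; split=> //; exact: vbasis_mem.
have [d [dc dW dnorm]] := normalizing_comm EW Xc An0 cc cW.
have dU := is_comm_mem dc.
have ltW : (\dim W < \dim (W + <[d]>))%N.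
  rewrite (ltn_leqif (dimv_leqif_sup (addvSl _ _))).
  by apply: contra dW => /subvP; apply; rewrite (subvP (addvSr _ _)) ?memv_line.
have leW : (\dim (W + <[d]>) <= \dim {:V})%N by rewrite dimvS ?subvf.
apply: (IH (W + <[d]>)%VS).
  by rewrite (leq_trans _ le_m) // ltn_sub2l // (leq_trans ltW).
exists (d :: X); split.
- by rewrite span_cons -EW addvC.
- by move=> e; rewrite inE => /orP[/eqP ->|/Xc].
- apply/lbr_subP=> p q /memv_addP[w wW [_ /vlineP[a ->] ->]].
  move=> /memv_addP[w' w'W [_ /vlineP[b ->] ->]].
  rewrite brDl !brDr !brZl !brZr brxx !scaler0 addr0.
  apply: (subvP (addvSl _ _)).
  by rewrite !rpredD ?rpredZ ?(brC d w) ?rpredN ?dnorm ?subalg_br.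
exists (n * N)%N; apply: extend_nil => //.
by case: dc => x [y [xU yU ->]] u uU; exact: cnil.
Qed.

(** Bracketing with [U, U] eventually kills [U], and a fortiori the lower central series of
    [U, U]. *)
Lemma engel_commutators : strongly_solvable br U.
Proof.
have [X [_ _ _ [n An0]]] := comm_nil_subalg_derived.
exists n; apply/eqP; rewrite -subv0 -An0; elim: n {An0} => [|n IH] //=.
by rewrite lbr_sym; apply: lbrS.
Qed.

End Engel.

Lemma strongly_solvable_of_two_gen U : subalg br U ->
  solvable br U \/ infinite_field F -> two_gen_strongly_solvable U ->
  strongly_solvable br U.
Proof.
move=> sU hyp ssU; apply: engel_commutators => // x y u xU yU uU.
by case: hyp => [solU|infF]; [exact: (comm_nil_solvable solU)
  | exact: (comm_nil_infinite infF sU)].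
Qed.

(** * Proper ideals in the non-solvable case *)

Section Minimal.
Hypothesis proper_ss : forall U, proper_subalg br U -> strongly_solvable br U.
Hypothesis not_solvable : ~ solvable br fullv.

Definition proper_ideal I := ideal br I /\ I != fullv.

Lemma proper_solvable U : subalg br U -> U != fullv -> solvable br U.
Proof.
by move=> sU nU; apply: strongly_solvable_solvable => //; apply: proper_ss.
Qed.

Lemma dser_add_ideal I S n : ideal br I -> subalg br S ->
  (dser br (I + S) n <= I + dser br S n)%VS.
Proof.
move=> idI sS; elim: n => [|n IH]; first exact: subvv.
apply/lbr_subP=> p q /(subvP IH)/memv_addP[i iI [s sD ->]].
move=> /(subvP IH)/memv_addP[j jI [t tD ->]].
rewrite brDl [br s _]brDr addrA memv_add ?mem_lbr //.
by apply: rpredD; last exact: ideal_br; rewrite brC rpredN; exact: ideal_br.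
Qed.

(** If I + S were L, a derived term of L would lie in [I], which is solvable, making L solvable. *)
Lemma proper_ideal_add I S : proper_ideal I -> subalg br S -> S != fullv ->
  (I + S)%VS != fullv.
Proof.
move=> [idI nI] sS nS; apply/negP=> /eqP IS; apply: not_solvable.
have [n Sn0] := proper_solvable sS nS.
have [m Im0] := proper_solvable (ideal_subalg idI) nI.
exists (n + m)%N; apply/eqP; rewrite dserD -subv0 -Im0; apply: dserS.
by rewrite -IS; apply: subv_trans (dser_add_ideal n idI sS) _; rewrite Sn0 addv0.
Qed.

Lemma zero_proper_ideal : proper_ideal 0%VS.
Proof.
split.
  by apply/lbr_subP=> u w _; rewrite memv0 => /eqP ->; rewrite br0r mem0v.
by apply/negP=> /eqP V0; apply: not_solvable; exists 0%N.
Qed.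

(** The sum of two proper ideals is proper by [proper_ideal_add], so a maximal one contains all
    others. *)
Lemma largest_proper_ideal : exists R, proper_ideal R /\
  forall I, proper_ideal I -> (I <= R)%VS.
Proof.
have [R [pR _ maxR]] := max_subspace zero_proper_ideal.
exists R; split=> // I [idI nI]; have [idR nR] := pR.
rewrite -[X in (_ <= X)%VS](maxR (R + I)%VS) ?addvSl ?addvSr //; split.
  apply/lbr_subP=> u _ uV /memv_addP[r rR [i iI ->]].
  by rewrite brDr memv_add // (ideal_br _ idR, ideal_br _ idI).
exact: proper_ideal_add (ideal_subalg idI) nI.
Qed.

(** A maximal subalgebra M not containing [R] would give R + M = L. Conversely, a maximal subalgebra
    exists, so an ideal inside all of them is proper, hence inside [R]. *)
Lemma largest_proper_ideal_frattini R : proper_ideal R ->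
  (forall I, proper_ideal I -> (I <= R)%VS) -> is_frattini br R.
Proof.
move=> pR maxR; have [idR nR] := pR; split=> // [M [sM nM maxM]|I idI subM].
  have sRM : subalg br (R + M)%VS.
    by apply: subv_trans (dser_add_ideal 1 idR sM) _; rewrite addvS.
  have [<-|RM] := maxM _ sRM (addvSr _ _); first exact: addvSl.
  by have := proper_ideal_add pR sM nM; rewrite RM eqxx.
apply: maxR; split=> //; apply/negP => /eqP IV.
have [id0 n0] := zero_proper_ideal.
have [M [[sM nM] _ maxM]] := max_subspace (P := proper_subalg br)
  (conj (ideal_subalg id0) n0).
case/negP: (nM); rewrite eqEsubv subvf -IV /=; apply: subM; split=> // S sS MS.
have [|nS] := eqVneq S fullv; first by right.
by left; exact: maxM.
Qed.

End Minimal.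

End LieAlgebra.

(** * Simplicity of the quotient *)

Lemma largest_proper_ideal_simple (F : fieldType) (V : vectType F)
    (br : V -> V -> V) (R : {vspace V}) : is_lie br ->
  (forall U, proper_subalg br U -> strongly_solvable br U) ->
  ~ solvable br fullv -> proper_ideal br R ->
  (forall I, proper_ideal br I -> (I <= R)%VS) -> simple_quotient br R.
Proof.
move=> lieB proper_ss not_solvable [idR nR] maxR.
(* The quotient is modelled on a complement of [R], the image of a projection with kernel [R]. *)
pose g : 'End(V) := (\1 - projv R)%VF.
have gE v : g v = v - projv R v by rewrite add_lfunE opp_lfunE id_lfunE.
have gR v : (g v == 0) = (v \in R).
  rewrite gE subr_eq0; apply/eqP/idP => [->|vR]; first exact: memv_proj.
  by rewrite projv_id.
pose W := subvs_of (limg g).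
pose f : 'Hom(V, W) := (linfun (vsproj (limg g)) \o g)%VF.
have valf v : vsval (f v) = g v.
  by rewrite comp_lfunE lfunE /= vsprojK // memv_img ?memvf.
have fR v : (f v == 0) = (v \in R).
  rewrite -gR -valf; apply/eqP/eqP => [->|]; first exact: linear0.
  by move=> fv0; apply/val_inj/(etrans fv0); rewrite linear0.
have fval w : f (vsval w) = w.
  apply: val_inj; rewrite /= valf; have /memv_imgP[v _ ->] := subvsP w.
  by rewrite !gE linearB /= projv_proj subrr subr0.
have fbr x y x' y' : f x = f x' -> f y = f y' -> f (br x y) = f (br x' y').
  move=> /eqP; rewrite -subr_eq0 -linearB fR => xR.
  move=> /eqP; rewrite -subr_eq0 -linearB fR => yR.
  apply/eqP; rewrite -subr_eq0 -linearB fR.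
  have -> : br x y - br x' y' = br (x - x') y + br x' (y - y').
    by rewrite (brDl lieB) (brNl lieB) (brDr lieB) (brNr lieB) addrA subrK.
  by apply: rpredD; last exact: ideal_br; rewrite (brC lieB) rpredN; exact: ideal_br.
pose brW (a b : W) : W := f (br (vsval a) (vsval b)).
have fM x y : f (br x y) = brW (f x) (f y) by apply: fbr; rewrite fval.
have onto w : exists v, w = f v by exists (vsval w); rewrite fval.
have lieW : is_lie brW.
  split=> [a x y z|a x y z|x|x y z].
  - by rewrite /brW linearP (brDl lieB) (brZl lieB) linearP.
  - by rewrite /brW linearP (brDr lieB) (brZr lieB) linearP.
  - by rewrite /brW (brxx lieB) linear0.
  have [[x' ->] [y' ->] [z' ->]] := And3 (onto x) (onto y) (onto z).
  rewrite -!fM -!linearD /=; case: lieB => _ _ _ ->; exact: linear0.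
have limgf : limg f = fullv.
  apply/eqP; rewrite eqEsubv subvf; apply/subvP=> w _.
  by rewrite -(fval w) memv_img ?memvf.
exists W, brW, f; split=> //; last first.
  by apply/vspaceP=> v; rewrite memv_ker fR.
split=> [|J idJ].
  (* An abelian quotient would put [L, L] inside the solvable ideal [R], so L would be solvable. *)
  apply/eqP=> W0; apply: not_solvable.
  have [n Rn0] := proper_solvable lieB proper_ss (ideal_subalg lieB idR) nR.
  exists (1 + n)%N; apply/eqP; rewrite dserD -subv0 -Rn0; apply: (dserS lieB).
  apply/(lbr_subP lieB)=> x y _ _; rewrite -fR fM -memv0 -W0.
  by apply: (mem_lbr lieW); exact: memvf.
(* The preimage of [J] is an ideal of L, hence everything or contained in [R], the kernel of [f]. *)
have idfJ : ideal br (f @^-1: J)%VS.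
  apply/(lbr_subP lieB)=> x y _; rewrite -!memv_preim fM => yJ.
  exact: (ideal_br lieW).
have fJ : (f @: (f @^-1: J))%VS = J by apply: lpreimK; rewrite limgf subvf.
have [fJV|nfJ] := eqVneq (f @^-1: J)%VS fullv.
  by right; rewrite -fJ fJV limgf.
left; apply/eqP; rewrite -fJ -lkerE; apply: subv_trans (maxR _ (conj idfJ nfJ)) _.
by apply/subvP=> v; rewrite memv_ker fR.
Qed.

Theorem theorem3p3 (F : fieldType) (V : vectType F) (br : V -> V -> V) :
  is_lie br ->
  (forall U : {vspace V}, proper_subalg br U -> two_generated br U ->
     strongly_solvable br U) ->
  (solvable br fullv -> ~ strongly_solvable br fullv ->
     (forall U : {vspace V}, proper_subalg br U -> strongly_solvable br U) /\
     two_generated br fullv) /\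
  (~ solvable br fullv ->
   (forall s : seq F, exists x : F, x \notin s) ->
   (exists p : nat, p \in [pchar F] /\ (5 < p)%N) ->
     [/\ two_generated br fullv,
         (forall U : {vspace V}, proper_subalg br U -> strongly_solvable br U)
       & exists Phi : {vspace V}, is_frattini br Phi /\ simple_quotient br Phi]).
Proof.
move=> lieB ss2.
have proper_ss : solvable br fullv \/ infinite_field F ->
    forall U, proper_subalg br U -> strongly_solvable br U.
  move=> hyp U [sU nU]; apply: (strongly_solvable_of_two_gen lieB) => //.
    case: hyp => [[n V0]|infF]; [left|by right]; exists n; apply/eqP.
    by rewrite -subv0 -V0; apply: (dserS lieB); exact: subvf.
  move=> T sT TU; apply: ss2; split=> //; apply: contra nU => /eqP TV.
  by rewrite eqEsubv subvf -TV.
have two_gen : solvable br fullv \/ infinite_field F ->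
    ~ strongly_solvable br fullv -> two_generated br fullv.
  (* If L were not two-generated, its two-generated subalgebras would all be proper, hence strongly
     solvable, and so would L. *)
  move=> hyp nss; apply: NNPP => n2; apply: nss.
  apply: (strongly_solvable_of_two_gen lieB (subvf _) hyp) => // T sT _ T2.
  by apply: ss2 (T2); split=> //; apply/eqP => TV; apply: n2; rewrite -TV.
split=> [sol nss|nsol infF _].
  by split; [apply: proper_ss; left | apply: two_gen => //; left].
have pss := proper_ss (or_intror infF).
split=> //; first apply: two_gen; first by right.
  by move=> /(strongly_solvable_solvable lieB (subvf _)).
have [R [pR maxR]] := largest_proper_ideal lieB pss nsol.
exists R; split; first exact: (largest_proper_ideal_frattini lieB pss nsol).
exact: (largest_proper_ideal_simple lieB pss nsol).
Qed.
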